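(* In the axiom system $\mathtt{TMM}\setminus\{\mathtt{spec}\}$, the scheme $\mathtt{ALLeq}$ cannot be weakened by adding any disjoint variable condition: for each $D\in\{\{x,y\},\{x,\phi\},\{y,\phi\}\}$, the scheme $\mathtt{ALLeq}$ (i.e. $\forall x\,x\equiv y\to(\forall x\,\phi\to\forall y\,\phi)$ without disjoint variable conditions) is not provable from the set of schemes consisting of $\mathtt{TMM}\setminus\{\mathtt{spec},\mathtt{ALLeq}\}$ together with the scheme $(\forall x\,x\equiv y\to(\forall x\,\phi\to\forall y\,\phi),\ \{D\})$. In particular, $\mathtt{ALLeq}$ is independent in $\mathtt{TMM}\setminus\{\mathtt{spec}\}$.
   Context: **Metavariables and metaformulas.** Let $\mathrm{vrMV}=\{x_i\mid i\in\omega\}$ (variable metavariables) and $\mathrm{fmMV}=\{\phi_i\mid i\in\omega\}$ (formula metavariables) be disjoint countably infinite sets of symbols, and $\mathrm{MV}=\mathrm{vrMV}\cup\mathrm{fmMV}$. A language $\mathcal L$ is a set of further symbols (nonlogical predicates) with an arity function $\mathcal L\to\omega$. Fix a language $\mathcal L$. A metaformula is one of: a formula metavariable; $x_i\equiv x_j$; $P(x_{i_1},\dots,x_{i_r})$ with $P\in\mathcal L$ of arity $r$; $\forall x_i\,\Phi$; $\neg\Phi$; $\Phi\to\Psi$, where $\Phi,\Psi$ are metaformulas. $\mathrm{MF}$ is the set of metaformulas. $\mathrm{OC}(\Phi)\subseteq\mathrm{MV}$ is the set of metavariables occurring in $\Phi$ (including those directly after a quantifier), and $\mathrm{OC}(x_i)=\{x_i\}$.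 For a set $X$, $\mathcal P_2(X)$ is the set of its two-element subsets. **Schemes.** A scheme $\Phi=(\{\Phi_1,\dots,\Phi_n\},\Phi_0,\mathrm{DV}(\Phi))$ consists of a finite set of metaformulas (hypotheses), a metaformula (conclusion), and a set $\mathrm{DV}(\Phi)\subseteq\mathcal P_2(\mathrm{OC}(\Phi))$ (disjoint variable conditions), where $\mathrm{OC}(\Phi)$ is the set of metavariables occurring in its hypotheses or conclusion. Writing $(\Phi_I,\Phi_0,D)$ with a larger $D$ means that $D$ is intersected with $\mathcal P_2(\mathrm{OC}(\Phi))$. Such a scheme is displayed as $\Phi_1\;\&\;\dots\;\&\;\Phi_n\Longrightarrow\Phi_0,\ \mathrm{DV}(\cdot,\cdot),\dots$, where $\mathrm{DV}(m,n)$ denotes the condition $\{m,n\}$; a scheme without hypotheses is written $(\Phi_0,\mathrm{DV}(\Phi))$. **Substitution and instances.** A substitution is a map $\sigma:\mathrm{MV}\to\mathrm{vrMV}\cup\mathrm{MF}$ with $\sigma(\mathrm{vrMV})\subseteq\mathrm{vrMV}$, $\sigma(\mathrm{fmMV})\subseteq\mathrm{MF}$ and $\sigma(m)=m$ for all but finitely many $m$. $\Phi^\sigma$ is the result of simultaneous plain substitution in the metaformula $\Phi$ (variable metavariables after quantifiers are also replaced). For $D\subseteq\mathcal P_2(\mathrm{MV})$, $D^\sigma=\{\{m,n\}\in\mathcal P_2(\mathrm{MV})\mid\exists\{m',n'\}\in D,\ m\in\mathrm{OC}(\sigma(m')),\ n\in\mathrm{OC}(\sigma(n'))\}$. $\sigma$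 is legitimate on a scheme $\Phi$ if $\{m,n\}\in\mathrm{DV}(\Phi)$ implies $\mathrm{OC}(\sigma(m))\cap\mathrm{OC}(\sigma(n))=\varnothing$. A scheme $\Psi$ is an instance of $\Phi$ if for some $\sigma$ legitimate on $\Phi$ the hypotheses and conclusion of $\Psi$ are the images under $\sigma$ of those of $\Phi$ and $\mathrm{DV}(\Phi)^\sigma\subseteq\mathrm{DV}(\Psi)$. **Proofs.** A proof of a scheme $\Phi$ from a set of schemes $S$ is a finite sequence $P$ of metaformulas (lines) whose last line is the conclusion of $\Phi$ and such that each line $P_i$ that is not a hypothesis of $\Phi$ admits $i_1,\dots,i_n<i$ for which $(\{P_{i_1},\dots,P_{i_n}\},P_i,\mathrm{DV}(P))$ is an instance of a scheme in $S$, where $\mathrm{DV}(P)=\mathrm{DV}(\Phi)\cup\{\{m,n\}\mid m\in\mathrm{OC}(P)\setminus\mathrm{OC}(\Phi),\ n\in\mathrm{OC}(P),\ m\ne n\}$ and $\mathrm{OC}(P)$ is the set of metavariables occurring in the lines of $P$ (or in $\Phi$). $\Phi$ is provable from $S$ if such a proof exists. A scheme is independent in a set of schemes containing it if it is not provable from the other schemes of that set. (Provability does not depend on the choice of the language containing the symbols involved.) **The system $\mathtt{TMM}$.** With $x,y,z$ distinct variable metavariables and $\phi,\psi,\chi,\theta,\tau$ distinct formula metavariables, $\mathtt{TMM}$ is the set of the following schemes: - $\mathtt{mp}$: $\phi\;\&\;\phi\to\psi\Longrightarrow\psi$ - $\mathtt{minimp}$: $\phi\to((\psi\to\chi)\to(((\theta\to\psi)\to(\chi\to\tau))\to(\psi\to\tau)))$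 - $\mathtt{peirce}$: $((\phi\to\psi)\to\phi)\to\phi$ - $\mathtt{contrap}$: $(\phi\to\neg\psi)\to(\psi\to\neg\phi)$ - $\mathtt{notelim}$: $\neg\phi\to(\phi\to\psi)$ - $\mathtt{gen}$: $\phi\Longrightarrow\forall x\,\phi$ - $\mathtt{ALLdistr}$: $\forall x(\phi\to\psi)\to(\forall x\,\phi\to\forall x\,\psi)$ - $\mathtt{spec}$: $\forall x\,\phi\to\phi$ - $\mathtt{modal5}$: $\neg\forall x\,\phi\to\forall x\,\neg\forall x\,\phi$ - $\mathtt{vacGen}$: $\phi\to\forall x\,\phi,\ \mathrm{DV}(x,\phi)$ - $\mathtt{ALLcomm}$: $\forall x\forall y\,\phi\to\forall y\forall x\,\phi$ - $\mathtt{EQrefl}$: $x\equiv x$ - $\mathtt{EQsymm}$: $x\equiv y\to y\equiv x$ - $\mathtt{EQtrans}$: $x\equiv y\to(y\equiv z\to x\equiv z)$ - $\mathtt{denot}$: $x\equiv x\to\neg\forall y\,\neg\,y\equiv x,\ \mathrm{DV}(x,y)$ - $\mathtt{subst}$: $\forall x(x\equiv y\to(\phi\to\forall x(x\equiv y\to\phi))),\ \mathrm{DV}(x,y),\ \mathrm{DV}(y,\phi)$ - $\mathtt{ALLeq}$: $\forall x\,x\equiv y\to(\forall x\,\phi\to\forall y\,\phi)$ - $\mathtt{genEq}$: $\neg\forall x\,x\equiv y\to(\neg\forall x\,x\equiv z\to(y\equiv z\to\forall x\,y\equiv z))$ *)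

(* Defs.v *)
From mathcomp Require Import all_boot.
From mathcomp Require Export boolp classical_sets functions cardinality.

Set Implicit Arguments.
Unset Strict Implicit.
Unset Printing Implicit Defensive.

Local Open Scope classical_set_scope.

(* [vr i] is x_i and [fm i] is phi_i. *)
Inductive metavariable := vr of nat | fm of nat.
Notation MV := metavariable.

(* The symbols form an arbitrary type: neither decidable equality nor
   countability is assumed. *)
Record language := Language { symbol :> Type; arity : symbol -> nat }.

(* A variable metavariable x_i is represented by its index i where only
   variable metavariables may stand. *)
Inductive metaformula (L : language) :=
| Meta of nat
| Eq of nat & nat
| Pred (P : L) of (arity P).-tuple nat
| All of nat & metaformula L
| Neg of metaformula L
| Imp of metaformula L & metaformula L.
Arguments Meta {L} i.
Arguments Eq {L} i j.
Arguments Pred {L} P xs.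
Arguments All {L} i a.
Arguments Neg {L} a.
Arguments Imp {L} a b.
Notation MF := metaformula.

Declare Scope mf_scope.
Delimit Scope mf_scope with mf.
Bind Scope mf_scope with metaformula.
Notation "a ---> b" := (Imp a b) (at level 55, right associativity) : mf_scope.
Notation "i === j" := (Eq i j) (at level 50, no associativity) : mf_scope.

Fixpoint OC L (a : MF L) : set MV :=
  match a with
  | Meta i => [set fm i]
  | Eq i j => [set vr i; vr j]
  | Pred _ xs => [set vr i | i in [set i | i \in val xs]]
  | All i b => vr i |` OC b
  | Neg b => OC b
  | Imp b c => OC b `|` OC c
  end.

(* The set of two-element subsets of [X]. *)
Definition P2 T (X : set T) : set (set T) :=
  [set A | exists m n, [/\ X m, X n, m <> n & A = [set m; n]]].

Definition OC_of L (H : set (MF L)) (c : MF L) : set MV :=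
  (\bigcup_(a in H) OC a) `|` OC c.

Record scheme L := Scheme {
  hyps : set (MF L);
  concl : MF L;
  DV : set (set MV);
  finite_hyps : finite_set hyps;
  DV_sub : DV `<=` P2 (OC_of hyps concl)
}.

Definition OC_scheme L (Phi : scheme L) : set MV :=
  OC_of (hyps Phi) (concl Phi).

(* The scheme (H, c, D), where D may be too large and is cut down to the
   metavariables that occur. *)
Definition mk_scheme L (H : set (MF L)) (fH : finite_set H) (c : MF L)
    (D : set (set MV)) : scheme L :=
  @Scheme L H c (D `&` P2 (OC_of H c)) fH (@subIsetr _ D (P2 (OC_of H c))).

(* The two components are the restrictions of the substitution to the variable
   and to the formula metavariables. *)
Record substitution L := Substitution {
  vsub : nat -> nat;
  fsub : nat -> MF L;
  finite_vsub : finite_set [set i | vsub i <> i];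
  finite_fsub : finite_set [set i | fsub i <> Meta i]
}.

Fixpoint msubst L (s : substitution L) (a : MF L) : MF L :=
  match a with
  | Meta i => fsub s i
  | Eq i j => Eq (vsub s i) (vsub s j)
  | Pred P xs => Pred P (map_tuple (vsub s) xs)
  | All i b => All (vsub s i) (msubst s b)
  | Neg b => Neg (msubst s b)
  | Imp b c => Imp (msubst s b) (msubst s c)
  end.

(* OC(s(m)) *)
Definition OC_sub L (s : substitution L) (m : MV) : set MV :=
  match m with
  | vr i => [set vr (vsub s i)]
  | fm i => OC (fsub s i)
  end.

Definition DV_subst L (s : substitution L) (D : set (set MV)) : set (set MV) :=
  [set A | exists m n, [/\ m <> n, A = [set m; n] &
    exists m' n', [/\ D [set m'; n'], OC_sub s m' m & OC_sub s n' n]]].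

Definition legitimate L (s : substitution L) (Phi : scheme L) : Prop :=
  forall m n, DV Phi [set m; n] -> OC_sub s m `&` OC_sub s n = set0.

Definition is_instance L (Psi Phi : scheme L) : Prop :=
  exists s : substitution L,
    [/\ legitimate s Phi,
        hyps Psi = msubst s @` hyps Phi,
        concl Psi = msubst s (concl Phi) &
        DV_subst s (DV Phi) `<=` DV Psi].

Section Proofs.
Variables (L : language) (S : set (scheme L)) (Phi : scheme L).
(* A nonempty sequence of lines, the last one being [P ord_max]. *)
Variables (n : nat) (P : 'I_n.+1 -> MF L).

Definition OC_proof : set MV := (\bigcup_i OC (P i)) `|` OC_scheme Phi.

Definition DV_proof : set (set MV) :=
  DV Phi `|` [set A | exists m k, [/\ (OC_proof `\` OC_scheme Phi) m,
                                      OC_proof k, m <> k & A = [set m; k]]].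

Definition step (J : set 'I_n.+1) (i : 'I_n.+1) : scheme L :=
  mk_scheme (finite_image P (finite_finset (X := J))) (P i) DV_proof.

Definition is_proof : Prop :=
  P ord_max = concl Phi /\
  forall i, hyps Phi (P i) \/
    exists J : set 'I_n.+1, (forall j, J j -> j < i) /\
      exists2 Psi, S Psi & is_instance (step J i) Psi.

End Proofs.

Definition provable L (S : set (scheme L)) (Phi : scheme L) : Prop :=
  exists n (P : 'I_n.+1 -> MF L), is_proof S Phi P.

Definition independent L (Phi : scheme L) (S : set (scheme L)) : Prop :=
  S Phi /\ ~ provable (S `\ Phi) Phi.

Section TMM.
Variable L : language.
Local Open Scope mf_scope.

Definition rule0 (c : MF L) (D : set (set MV)) : scheme L :=
  mk_scheme (finite_set0 _) c D.

Definition rule1 (h c : MF L) : scheme L :=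
  mk_scheme (finite_set1 h) c set0.

Definition rule2 (h1 h2 c : MF L) : scheme L :=
  mk_scheme (finite_set2 h1 h2) c set0.

(* Indices of the metavariables in which the schemes are displayed. *)
Variables (x y z phi psi chi theta tau : nat).
Let f : MF L := Meta phi.
Let g : MF L := Meta psi.
Let h : MF L := Meta chi.
Let t : MF L := Meta theta.
Let u : MF L := Meta tau.

Definition mp := rule2 f (f ---> g) g.
Definition minimp :=
  rule0 (f ---> ((g ---> h) --->
                 (((t ---> g) ---> (h ---> u)) ---> (g ---> u)))) set0.
Definition peirce := rule0 (((f ---> g) ---> f) ---> f) set0.
Definition contrap := rule0 ((f ---> Neg g) ---> (g ---> Neg f)) set0.
Definition notelim := rule0 (Neg f ---> (f ---> g)) set0.
Definition gen := rule1 f (All x f).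
Definition ALLdistr :=
  rule0 (All x (f ---> g) ---> (All x f ---> All x g)) set0.
Definition spec := rule0 (All x f ---> f) set0.
Definition modal5 := rule0 (Neg (All x f) ---> All x (Neg (All x f))) set0.
Definition vacGen := rule0 (f ---> All x f) [set [set vr x; fm phi]].
Definition ALLcomm := rule0 (All x (All y f) ---> All y (All x f)) set0.
Definition EQrefl := rule0 (x === x) set0.
Definition EQsymm := rule0 (x === y ---> y === x) set0.
Definition EQtrans := rule0 (x === y ---> (y === z ---> x === z)) set0.
Definition denot :=
  rule0 (x === x ---> Neg (All y (Neg (y === x)))) [set [set vr x; vr y]].
Definition substEq :=
  rule0 (All x (x === y ---> (f ---> All x (x === y ---> f))))
        [set [set vr x; vr y]; [set vr y; fm phi]].
Definition ALLeqDV (D : set (set MV)) :=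
  rule0 (All x (x === y) ---> (All x f ---> All y f)) D.
Definition ALLeq := ALLeqDV set0.
Definition genEq :=
  rule0 (Neg (All x (x === y)) --->
         (Neg (All x (x === z)) ---> (y === z ---> All x (y === z)))) set0.

Definition TMM : set (scheme L) :=
  [set mp; minimp; peirce; contrap; notelim; gen; ALLdistr; spec; modal5;
       vacGen; ALLcomm; EQrefl; EQsymm; EQtrans; denot; substEq; ALLeq; genEq].

End TMM.
Arguments TMM : clear implicits.

(* Main.v *)
Require Import Defs.
From mathcomp Require Import all_boot.

Local Open Scope classical_set_scope.

(** Every metavariable is interpreted over a world made of an assignment of
    booleans to the variables and of one extra bit [p].  The variables x and y
    share a single memory cell, so that x = y always holds; quantifying over x
    or over y quantifies over that cell, but quantifying over x also sets the
    bit [p].  Reading phi as [p], the premises [All x (x = y)] and [All x phi]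
    of ALLeq hold everywhere while [All y phi] fails where [p] is unset.
    In a proof of ALLeq only the pairs containing a dummy metavariable (one
    other than x, y, phi) are declared disjoint, and dummies ignore the bit
    and the shared cell; so all the axioms but spec are sound, and the
    weakenings of ALLeq are too, because they apply to x and y either never or
    only when phi is replaced by a formula in dummies alone. *)

Section Model.
Set Implicit Arguments.
Unset Strict Implicit.

Variables (L : language) (x y phi : nat).
Hypothesis neq_xy : x != y.

Implicit Types (a b c : MF L) (e : nat -> bool) (p : bool).

(** * The model: worlds, truth and validity *)

Definition cell (i : nat) : nat := if i == x then y else i.

Definition upd e (i : nat) (v : bool) : nat -> bool :=
  fun j => if j == i then v else e j.

(** The bit is never cleared, only joined by disjunction, so repeating or permuting quantifiers has
    no further effect on it. *)
Fixpoint sem a e p : bool :=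
  match a with
  | Meta i => (i == phi) && p
  | Eq i j => e (cell i) == e (cell j)
  | Pred _ _ => false
  | All i b => [forall v, sem b (upd e (cell i) v) ((i == x) || p)]
  | Neg b => ~~ sem b e p
  | Imp b c => sem b e p ==> sem c e p
  end.

Definition valid a : Prop := forall e p, sem a e p.

Definition core (m : MV) : bool :=
  match m with vr i => (i == x) || (i == y) | fm i => i == phi end.

(** This is what the disjointness conditions of a proof of [ALLeq] guarantee: every declared pair
    contains a dummy, that is, a metavariable that is not core. *)
Definition apart (m n : MV) : Prop := m <> n /\ ~~ (core m && core n).

Definition fresh (i : nat) a : Prop := forall n, OC a n -> apart (vr i) n.

(** * Updates, shared cells and vacuous quantification *)

Lemma neq_vr : vr x <> vr y.
Proof. by case=> exy; move: neq_xy; rewrite exy eqxx. Qed.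

Lemma upd_same e i v : upd e i v i = v.
Proof. by rewrite /upd eqxx. Qed.

Lemma upd_other e i j v : j != i -> upd e i v j = e j.
Proof. by rewrite /upd => /negPf ->. Qed.

Lemma upd_upd e i v w : upd (upd e i v) i w = upd e i w.
Proof. by apply/funext => j; rewrite /upd; case: eqP. Qed.

Lemma upd_comm e i j v w :
  i != j -> upd (upd e i v) j w = upd (upd e j w) i v.
Proof.
move=> ij; apply/funext => k; rewrite /upd.
by case: (k =P j) => // ->; rewrite eq_sym (negPf ij).
Qed.

Lemma cell_eq {i j} :
  cell i = cell j -> i = j \/ core (vr i) && core (vr j).
Proof.
rewrite /cell /=.
case: (i =P x) => [->|_]; case: (j =P x) => [->|_] /=; first by left.
- by move=> <-; right; rewrite eqxx.
- by move=> ->; right; rewrite eqxx.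
- by left.
Qed.

Lemma apart_cell {i j} : apart (vr i) (vr j) -> cell i != cell j.
Proof.
move=> [ij nc]; apply/eqP => /cell_eq [eij|]; last exact/negP.
by apply: ij; rewrite eij.
Qed.

Lemma sem_eq_on a e e' p p' :
  (forall j, OC a (vr j) -> e (cell j) = e' (cell j)) ->
  (OC a (fm phi) -> p = p') -> sem a e p = sem a e' p'.
Proof.
elim: a e e' p p' => [i|i j|P xs|i b IH|b IH|b IHb c IHc] e e' p p' /= He Hp.
- by case: (i =P phi) => [ei|] //=; apply: Hp; rewrite ei.
- by rewrite !He //; [right|left].
- by [].
- apply: eq_forallb => v; apply: IH => [j Hj|Hj].
    by rewrite /upd He //; right.
  by rewrite Hp //; right.
- by congr (~~ _); apply: IH.
- have -> : sem b e p = sem b e' p'.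
    by apply: IHb => [j Hj|Hj]; [apply: He|apply: Hp]; left.
  have -> // : sem c e p = sem c e' p'.
  by apply: IHc => [j Hj|Hj]; [apply: He|apply: Hp]; right.
Qed.

(** No variable of [a] shares the cell of [i]. If phi occurs in [a], then [i] is not core, hence not
    x, and the bit is unchanged. *)
Lemma sem_fresh {i a} e v p :
  fresh i a -> sem a (upd e (cell i) v) ((i == x) || p) = sem a e p.
Proof.
move=> Ha; apply: sem_eq_on => [j /Ha/apart_cell ij|/Ha [_ /=]].
  by rewrite upd_other // eq_sym.
by rewrite eqxx andbT; case: (i == x).
Qed.

Lemma sem_All_fresh {i a} e p : fresh i a -> sem (All i a) e p = sem a e p.
Proof.
move=> Ha /=; apply/forallP/idP => [/(_ true)|H v]; by rewrite sem_fresh.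
Qed.

Lemma sem_All_Eq {i j} e p : sem (All i (Eq i j)) e p -> cell i = cell j.
Proof.
(* This value falsifies the equation unless the two cells coincide. *)
move=> /forallP /(_ (~~ e (cell j))) /=; rewrite upd_same.
by case: (cell j =P cell i) => [->|/eqP ji] //; rewrite upd_other //; case: (e _).
Qed.

(** * Validity of the axioms in the model *)

Lemma valid_ALLdistr i a b :
  valid (Imp (All i (Imp a b)) (Imp (All i a) (All i b))).
Proof.
move=> e p /=; apply/implyP => /forallP Hab; apply/implyP => /forallP Ha.
by apply/forallP => v; move/implyP: (Hab v); apply.
Qed.

(** The inner quantifier overwrites the cell set by the outer one, and setting the bit twice is
    setting it once. *)
Lemma valid_modal5 i a :
  valid (Imp (Neg (All i a)) (All i (Neg (All i a)))).
Proof.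
move=> e p /=; apply/implyP => H; apply/forallP => v; move: H.
congr (~~ _); apply: eq_forallb => w.
by rewrite upd_upd orbA orbb.
Qed.

Lemma valid_vacGen i a : fresh i a -> valid (Imp a (All i a)).
Proof.
by move=> Ha e p; apply/implyP => H; apply: etrans (sem_All_fresh _ _ Ha) H.
Qed.

Lemma valid_ALLcomm i j a :
  valid (Imp (All i (All j a)) (All j (All i a))).
Proof.
move=> e p /=; apply/implyP => /forallP H; apply/forallP => v; apply/forallP => w.
(* On a shared cell only the last value written survives; distinct cells can be updated in either
   order. *)
rewrite orbCA; case: (cell i =P cell j) => [eij|/eqP ij].
  by move/forallP: (H v) => /(_ w); rewrite eij !upd_upd.
by rewrite -upd_comm //; move/forallP: (H w) => /(_ v).
Qed.

Lemma valid_denot i j :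
  apart (vr i) (vr j) ->
  valid (Imp (Eq i i) (Neg (All j (Neg (Eq j i))))).
Proof.
move=> /apart_cell ij e p /=; rewrite eqxx /=.
by apply/forallPn; exists (e (cell i)); rewrite upd_same upd_other // eqxx.
Qed.

(** The cell of [j] is left alone, so both equations force the same value into the cell of [i]; the
    bit is already set by the outer quantifier if [i] is x. *)
Lemma valid_substEq i j a : apart (vr i) (vr j) ->
  valid (All i (Imp (Eq i j) (Imp a (All i (Imp (Eq i j) a))))).
Proof.
rewrite /valid /= => /apart_cell; rewrite eq_sym => ji e p.
apply/forallP => v; rewrite upd_same upd_other //.
apply/implyP => /eqP ->; apply/implyP => Ha; apply/forallP => w.
rewrite upd_same !upd_other //; apply/implyP => /eqP ->.
by rewrite upd_upd orbA orbb.
Qed.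

Lemma valid_genEq i j k :
  valid (Imp (Neg (All i (Eq i j))) (Imp (Neg (All i (Eq i k)))
    (Imp (Eq j k) (All i (Eq j k))))).
Proof.
(* On a shared cell the equation holds for every value, so each negated premise separates cells. *)
have aux l e p : ~~ sem (All i (Eq i l)) e p -> cell l != cell i.
  apply: contra => /eqP eli; apply/forallP => v /=.
  by rewrite eli eqxx.
move=> e p; apply/implyP => /(aux j e p) ji; apply/implyP => /(aux k e p) ki.
apply/implyP => /= ejk; apply/forallP => v.
by rewrite !upd_other.
Qed.

(** The first premise makes the cells equal. If [i] and [j] differ, both are core, so they are not
    apart; then [a] has no core metavariable and both quantifiers are vacuous. *)
Lemma valid_ALLeq i j a :
  apart (vr i) (vr j) \/ fresh i a \/ fresh j a ->
  valid (Imp (All i (Eq i j)) (Imp (All i a) (All j a))).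
Proof.
move=> H e p; apply/implyP => /(@sem_All_Eq i j e p) /cell_eq [->|cij].
  exact: implybb.
have core_fresh k l : core (vr k) -> core (vr l) -> fresh k a -> fresh l a.
  move=> ck cl Hk n /Hk [_]; rewrite /apart ck cl /= => nn; split=> // el.
  by rewrite -el cl in nn.
case/andP: (cij) => ci cj.
have [Hi Hj] : fresh i a /\ fresh j a.
  case: H => [[_ /negP/(_ cij)] //|[Hi|Hj]]; split=> //.
    exact: (core_fresh i).
  exact: (core_fresh j).
apply/implyP => Ha; apply: etrans (sem_All_fresh _ _ Hj) _.
by rewrite -(sem_All_fresh _ _ Hi).
Qed.

(** At the all-false world with the bit unset, quantifying over x sets the bit and makes phi true,
    while quantifying over y leaves phi false. *)
Lemma invalid_ALLeq : ~ valid (concl (ALLeq L x y phi)).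
Proof.
have yx : (y == x) = false by rewrite eq_sym (negPf neq_xy).
move=> /(_ (fun=> false) false) /implyP H.
have /implyP {}H : sem (Imp (All x (Meta phi)) (All y (Meta phi)))
    (fun=> false) false.
  by apply: H; apply/forallP => v /=; rewrite /cell eqxx yx.
have /forallP /(_ true) : sem (All y (Meta phi)) (fun=> false) false.
  by apply: H; apply/forallP => v /=; rewrite !eqxx.
by rewrite /= yx andbF.
Qed.

(** * From soundness of schemes to unprovability *)

Definition sound (Psi : scheme L) : Prop :=
  forall s : substitution L,
    (forall m' n' m n, DV Psi [set m'; n'] ->
       OC_sub s m' m -> OC_sub s n' n -> apart m n) ->
    (forall a, hyps Psi a -> valid (msubst s a)) ->
    valid (msubst s (concl Psi)).

Lemma set2_eq T (a b c d : T) :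
  [set a; b] = [set c; d] -> a = c /\ b = d \/ a = d /\ b = c.
Proof.
move=> E.
have [ac|ac] : [set c; d] a by rewrite -E; left.
- have [bc|bd] : [set c; d] b by rewrite -E; right.
    have [da|db] : [set a; b] d by rewrite E; right.
      by left; split=> //; rewrite bc da ac.
    by left.
  by left.
- have [bc|bd] : [set c; d] b by rewrite -E; right.
    by right.
  have [ca|cb] : [set a; b] c by rewrite E; left.
    by left; split=> //; rewrite ca.
  by right.
Qed.

Lemma core_OC m : core m -> OC_scheme (ALLeq L x y phi) m.
Proof.
case: m => [i /=|i /= /eqP ->]; last by right; right; right; right.
by case/orP => /eqP ->; right; left; [left|right; right].
Qed.

(** [ALLeq] declares no conditions, so each pair comes from the dummy clause, and a dummy is not
    core because x, y and phi all occur in [ALLeq]. *)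
Lemma DV_proof_core n (P : 'I_n.+1 -> MF L) m k :
  DV_proof (ALLeq L x y phi) P [set m; k] -> ~~ (core m && core k).
Proof.
case=> [[]//|[m' [k' [[_ nm'] _ _ E]]]]; apply/negP => /andP[cm ck].
by apply: nm'; apply: core_OC; case: (set2_eq E) => -[mE kE]; rewrite -?mE -?kE.
Qed.

(** By strong induction all lines of a proof would be valid, including the last one, [ALLeq]
    itself. *)
Lemma sound_unprovable (S : set (scheme L)) :
  (forall Psi, S Psi -> sound Psi) -> ~ provable S (ALLeq L x y phi).
Proof.
move=> HS [n [P [Plast Pstep]]]; apply: invalid_ALLeq; rewrite -Plast.
suff H k (i : 'I_n.+1) : i < k -> valid (P i) by exact: (H n.+1).
elim: k i => // k IH i ik.
have [//|[J [Jlt [Psi SPsi [s [leg eqh eqc subD]]]]]] := Pstep i.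
rewrite -[P i]/(concl (step (ALLeq L x y phi) P J i)) eqc.
apply: (HS _ SPsi s) => [m' n' m k' Dm Hm Hk|a ha].
  (* Legitimacy supplies the distinctness needed for the pair to count among the substituted
     conditions. *)
  have mk : m <> k'.
    by move=> mk; have : classical_sets.set0 m by rewrite -(leg _ _ Dm); split=> //; rewrite mk.
  split=> //; apply: (@DV_proof_core _ P).
  by have [] : DV (step (ALLeq L x y phi) P J i) [set m; k'];
    first by apply: subD; exists m, k'; split=> //; exists m', n'.
have : hyps (step (ALLeq L x y phi) P J i) (msubst s a) by rewrite eqh; exists a.
by case=> j Jj <-; apply: IH; apply: leq_trans (Jlt _ Jj) _.
Qed.

(** * Soundness of the individual schemes *)

Lemma DV_mk_scheme (H : set (MF L)) (fH : finite_set H) c D m n :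
  D [set m; n] -> OC_of H c m -> OC_of H c n -> m <> n ->
  DV (mk_scheme fH c D) [set m; n].
Proof. by move=> Dmn Hm Hn mn; split=> //; exists m, n. Qed.

Lemma sound_rule0 c D :
  (forall s : substitution L,
     (forall m' n' m n, D [set m'; n'] -> OC c m' -> OC c n' -> m' <> n' ->
        OC_sub s m' m -> OC_sub s n' n -> apart m n) ->
     valid (msubst s c)) ->
  sound (rule0 c D).
Proof.
move=> H s Hs _; apply: H => m' n' m n Dmn Om On mn; apply: Hs.
by apply: DV_mk_scheme => //; right.
Qed.

Lemma sound_TMM z psi chi theta tau :
  TMM L x y z phi psi chi theta tau `\` [set spec L x phi; ALLeq L x y phi]
    `<=` sound.
Proof.
move=> Psi [HT /not_orP [nspec nALLeq]]; move: HT nspec nALLeq.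
have taut c : (forall s : substitution L, valid (msubst s c)) ->
    sound (rule0 c classical_sets.set0).
  by move=> Hc; apply: sound_rule0 => s _; exact: Hc.
(* The set is a left-nested union, so the schemes are peeled off from [genEq] back to [mp]; [ALLeq]
   and [spec] are excluded by assumption. *)
case; last first.
  by move=> -> _ _; apply: taut => s; exact: valid_genEq.
case; last by [].
case; last first.
  move=> -> _ _; apply: sound_rule0 => s Hs; apply: valid_substEq.
  apply: (Hs (vr x) (vr y)) => //; first by left.
  - by left.
  - by right; left; right.
  - exact: neq_vr.
case; last first.
  move=> -> _ _; apply: sound_rule0 => s Hs; apply: valid_denot.
  apply: (Hs (vr x) (vr y)) => //.
  - by left; left.
  - by right; left.
  - exact: neq_vr.
case; last first.
  move=> -> _ _; apply: taut => s e p /=.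
  by apply/implyP => /eqP ->; exact: implybb.
case; last first.
  by move=> -> _ _; apply: taut => s e p /=; rewrite eq_sym implybb.
case; last first.
  by move=> -> _ _; apply: taut => s e p /=; rewrite eqxx.
case; last first.
  by move=> -> _ _; apply: taut => s; exact: valid_ALLcomm.
case; last first.
  move=> -> _ _; apply: sound_rule0 => s Hs; apply: valid_vacGen => n On.
  apply: (Hs (vr x) (fm phi)) => //.
  - by right; left.
  - by left.
case; last first.
  by move=> -> _ _; apply: taut => s; exact: valid_modal5.
case; last by [].
case; last first.
  by move=> -> _ _; apply: taut => s; exact: valid_ALLdistr.
case; last first.
  (* Validity ranges over all worlds, hence covers the one reached by the quantifier. *)
  move=> -> _ _ s _ H e p; apply/forallP => v; exact: (H (Meta phi)).
case; last first.
  by move=> -> _ _; apply: taut => s e p /=; do 2!case: (sem _ e p).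
case; last first.
  by move=> -> _ _; apply: taut => s e p /=; do 2!case: (sem _ e p).
case; last first.
  by move=> -> _ _; apply: taut => s e p /=; do 2!case: (sem _ e p).
case; last first.
  by move=> -> _ _; apply: taut => s e p /=; do 5!case: (sem _ e p).
move=> -> _ _ s _ H e p.
have /implyP := H (Imp (Meta phi) (Meta psi)) (or_intror erefl) e p.
by apply; apply: (H (Meta phi)); left.
Qed.

Lemma sound_ALLeqDV (D : set MV) :
  [set [set vr x; vr y]; [set vr x; fm phi]; [set vr y; fm phi]] D ->
  sound (ALLeqDV L x y phi [set D]).
Proof.
move=> HD; apply: sound_rule0 => s Hs; apply: valid_ALLeq.
case: HD Hs => [[->|->]|->] Hs.
- left; apply: (Hs (vr x) (vr y)) => //.
  + by left; left.
  + by right; right; left.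
  + exact: neq_vr.
- right; left => n On; apply: (Hs (vr x) (fm phi)) => //.
  + by left; left.
  + by right; left; right.
- right; right => n On; apply: (Hs (vr y) (fm phi)) => //.
  + by left; right; right.
  + by right; left; right.
Qed.

End Model.

(** * Monotonicity of provability, the weakenings and independence *)

Lemma provable_mono {L : language} {S S' : set (scheme L)} {Phi : scheme L} :
  S `<=` S' -> provable S Phi -> provable S' Phi.
Proof.
move=> SS' [n [P [Plast Pstep]]]; exists n, P; split=> // i.
have [|[J [Jlt [Psi SPsi HPsi]]]] := Pstep i; first by left.
by right; exists J; split=> //; exists Psi => //; exact: SS'.
Qed.

Theorem proposition3p10 (L : language)
    (x y z phi psi chi theta tau : nat)
    (distinct_vr : uniq [:: x; y; z])
    (distinct_fm : uniq [:: phi; psi; chi; theta; tau]) :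
  let T := TMM L x y z phi psi chi theta tau in
  let Spec := spec L x phi in
  let AllEq := ALLeq L x y phi in
  (forall D : set MV,
     [set [set vr x; vr y]; [set vr x; fm phi]; [set vr y; fm phi]] D ->
     ~ provable ((T `\` [set Spec; AllEq]) `|` [set ALLeqDV L x y phi [set D]])
         AllEq)
  /\ independent AllEq (T `\ Spec).
Proof.
move=> T Spec AllEq.
have neq_xy : x != y by case/andP: distinct_vr; rewrite inE negb_or => /andP[].
have main (D : set MV) :
    [set [set vr x; vr y]; [set vr x; fm phi]; [set vr y; fm phi]] D ->
    ~ provable ((T `\` [set Spec; AllEq]) `|` [set ALLeqDV L x y phi [set D]])
        AllEq.
  move=> HD; apply: sound_unprovable => // Psi [HT|->].
    exact: (sound_TMM neq_xy HT).
  exact: sound_ALLeqDV.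
split=> //; split.
  by split; [left; right|move=> /(congr1 (@concl L))].
(* Any of the three conditions would serve: a proof without the weakened scheme is also a proof with
   it. *)
move=> H; apply: (main [set vr x; vr y]); first by left; left.
apply: provable_mono H => Psi [[HT nspec] nALLeq]; left; split=> //.
by case.
Qed.
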